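(* Consider a GMCLP instance $(\mathcal{I},\mathcal{J},(\mathcal{I}_j)_{j\in\mathcal{J}},(w_j)_{j\in\mathcal{J}},p)$. Let $(x^*,y^* )$ be an optimal solution of the GMCLP formulation (F) satisfying $$x^*_j=\min\{1,y^*(\mathcal{I}_j)\}=\max_{i\in\mathcal{I}_j}y^*_i\qquad\forall\,j\in\mathcal{J},$$ and let $j,r\in\mathcal{J}$ with $j\ne r$. Then $$x^*_j\le x^*_r+y^*(\mathcal{I}_j\setminus\mathcal{I}_r).$$
   Context: A GMCLP (generalized maximal covering location problem) instance consists of finite nonempty sets $\mathcal{I}$ (candidate facility locations) and $\mathcal{J}$ (customers), subsets $\mathcal{I}_j\subseteq\mathcal{I}$ for $j\in\mathcal{J}$, real weights $w_j$ for $j\in\mathcal{J}$ (positive or negative), and an integer $p$ with $1\le p\le|\mathcal{I}|$. Put $\mathcal{N}=\{j\in\mathcal{J}: w_j<0\}$. For a vector $a$ and a subset $\mathcal{S}$ of its index set, $a(\mathcal{S})=\sum_{i\in\mathcal{S}}a_i$. A maximum over an empty index set of components $y_i$ is read as $0$. The GMCLP formulation (F) is: maximize $\sum_{j\in\mathcal{J}}w_jx_j$ subject to $y(\mathcal{I})=p$; $y(\mathcal{I}_j)\ge x_j$ for all $j\in\mathcal{J}\setminus\mathcal{N}$; $x_j\ge y_i$ for all $j\in\mathcal{N}$, $i\in\mathcal{I}_j$; $x_j\in\{0,1\}$ for all $j\in\mathcal{J}$; $y_i\in\{0,1\}$ for all $i\in\mathcal{I}$. *)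

(* Defs.v *)
From HB Require Import structures.
From mathcomp Require Import all_boot all_order all_algebra.
From mathcomp Require Import reals.

Set Implicit Arguments.
Unset Strict Implicit.
Unset Printing Implicit Defensive.

Import Order.TTheory GRing.Theory Num.Theory.
Local Open Scope ring_scope.

(* Generalized maximal covering location problem with candidate facility
   locations [I] and customers [J]. *)
Record gmclp (R : realType) (I J : finType) := Gmclp {
  covering : J -> {set I};
  weight : J -> R;
  nb_open : nat;
  locations_nonempty : (0 < #|I|)%N;
  customers_nonempty : (0 < #|J|)%N;
  nb_open_bounds : (1 <= nb_open <= #|I|)%N
}.

(* a(S), the sum of the components of the vector a indexed by S *)
Definition sum_over (R : realType) (T : finType) (a : T -> R) (S : {set T}) : R :=
  \sum_(i in S) a i.

(* The seed 0 gives the convention max over the empty set = 0; it does not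
   affect nonempty maxima of nonnegative components, and only binary vectors
   are considered below. *)
Definition max_over (R : realType) (T : finType) (a : T -> R) (S : {set T}) : R :=
  \big[Num.max/0]_(i in S) a i.

Section Formulation.
Variables (R : realType) (I J : finType) (P : gmclp R I J).

Definition negative_customers : {set J} := [set j | weight P j < 0].

Definition binary (T : finType) (a : T -> R) : Prop :=
  forall t, a t = 0 \/ a t = 1.

Definition objective (x : J -> R) : R := \sum_(j : J) weight P j * x j.

Record feasible (x : J -> R) (y : I -> R) : Prop := Feasible {
  feasible_card : sum_over y [set: I] = (nb_open P)%:R;
  feasible_nonneg : forall j, j \in ~: negative_customers ->
    x j <= sum_over y (covering P j);
  feasible_neg : forall j, j \in negative_customers ->
    forall i, i \in covering P j -> y i <= x j;
  feasible_x : binary x;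
  feasible_y : binary y
}.

Definition optimal (x : J -> R) (y : I -> R) : Prop :=
  feasible x y /\
  forall (x' : J -> R) (y' : I -> R), feasible x' y' ->
    objective x' <= objective x.

End Formulation.

(* Main.v *)
Require Import Defs.
From mathcomp Require Import all_boot all_order all_algebra.
From mathcomp Require Import reals.
Import Order.TTheory GRing.Theory Num.Theory.
Local Open Scope ring_scope.

(** For a nonnegative vector [y], the set function sending [S] to
    [min 1 (y(S))] inherits subadditivity from [y]: splitting [A] along [B]
    gives [y(A) <= y(B) + y(A \ B)], and truncating at 1 keeps the inequality
    because [y(A \ B)] is nonnegative.  The optimal [x] is this truncation
    evaluated on the covering sets, and [y] is nonnegative because it is
    binary. *)

Lemma sum_over_ge0 (R : realType) (T : finType) (a : T -> R) (S : {set T}) :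
  (forall t, 0 <= a t) -> 0 <= sum_over a S.
Proof. by move=> a_ge0; apply: sumr_ge0. Qed.

Lemma sum_over_le_setD (R : realType) (T : finType) (a : T -> R)
    (A B : {set T}) :
  (forall t, 0 <= a t) -> sum_over a A <= sum_over a B + sum_over a (A :\: B).
Proof.
move=> a_ge0; rewrite /sum_over (big_setID B) /= lerD2r.
rewrite [leRHS](big_setID A) /= setIC lerDl.
exact: sum_over_ge0.
Qed.

(** If the truncation is active on [B], the right-hand side is already at
    least 1; otherwise the inequality is the untruncated one. *)
Lemma min1_sum_over_le_setD (R : realType) (T : finType) (a : T -> R)
    (A B : {set T}) :
  (forall t, 0 <= a t) ->
  Num.min 1 (sum_over a A)
    <= Num.min 1 (sum_over a B) + sum_over a (A :\: B).
Proof.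
move=> a_ge0; rewrite addr_minl le_min !ge_min lerDl sum_over_ge0 //=.
by rewrite sum_over_le_setD ?orbT.
Qed.

Theorem proposition5p1 (R : realType) (I J : finType) (P : gmclp R I J)
    (x : J -> R) (y : I -> R)
    (opt_xy : optimal P x y)
    (x_def : forall j : J,
       x j = Num.min 1 (sum_over y (covering P j)) /\
       Num.min 1 (sum_over y (covering P j)) = max_over y (covering P j))
    (j r : J) (neq_jr : j <> r) :
  x j <= x r + sum_over y (covering P j :\: covering P r).
Proof.
have [[_ _ _ _ y_bin] _] := opt_xy.
have y_ge0 i : 0 <= y i by case: (y_bin i) => ->.
have [-> _] := x_def j; have [-> _] := x_def r.
exact: min1_sum_over_le_setD.
Qed.
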